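(* The dual mutual-visibility number of the hypercube satisfies $\mu_d(Q_1)=2$, $\mu_d(Q_2)=3$, $\mu_d(Q_3)=4$, $\mu_d(Q_4)=8$, $\mu_d(Q_5)=10$, $\mu_d(Q_6)=20$, $\mu_d(Q_7)=29$. Moreover, if $h\ge 8$, then $2\cdot A(h,4) \le \mu_d(Q_h) \le 29\cdot 2^{h-7}$.
   Context: $Q_h$ is the hypercube with vertex set $\{0,1\}^h$, two strings adjacent iff they differ in exactly one position. For $M \subseteq V(G)$, a $u,v$-path is $M$-free if it contains no vertex of $M\setminus\{u,v\}$; $u,v$ are $M$-visible if there is an $M$-free shortest $u,v$-path. $M$ is a dual mutual-visibility set if every $u,v\in M$ are $M$-visible and every $u,v\in V(G)\setminus M$ are $M$-visible; $\mu_d(G)$ is the maximum size of such a set. $A(n,d)$ is the maximum size of a set $C \subseteq \{0,1\}^n$ such that any two distinct elements of $C$ differ in at least $d$ positions. *)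

(* Defs.v *)
From mathcomp Require Import all_boot.
From mathcomp Require Import boolp.

Set Implicit Arguments.
Unset Strict Implicit.
Unset Printing Implicit Defensive.

Section Visibility.

Variables (T : finType) (e : rel T).

(* As in path.v, the vertex list of the path is u :: p. *)
Definition is_upath (u v : T) (p : seq T) : bool :=
  [&& path e u p, last u p == v & uniq (u :: p)].

Definition is_shortest_path (u v : T) (p : seq T) : Prop :=
  is_upath u v p /\ (forall q : seq T, is_upath u v q -> size p <= size q).

Definition is_free (M : {set T}) (u v : T) (p : seq T) : Prop :=
  forall w : T, w \in u :: p -> w \notin M :\: [set u; v].

Definition visible (M : {set T}) (u v : T) : Prop :=
  exists p : seq T, is_shortest_path u v p /\ is_free M u v p.

Definition dual_mutual_visibility_set (M : {set T}) : Prop :=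
  (forall u v : T, u \in M -> v \in M -> visible M u v) /\
  (forall u v : T, u \notin M -> v \notin M -> visible M u v).

Definition mu_d : nat :=
  \max_(M : {set T} | `[< dual_mutual_visibility_set M >]) #|M|.

End Visibility.

Definition hamming (n : nat) (x y : n.-tuple bool) : nat :=
  #|[set i : 'I_n | tnth x i != tnth y i]|.

Definition hypercube (h : nat) : rel (h.-tuple bool) :=
  fun x y => hamming x y == 1.

Definition code_min_dist (n d : nat) (C : {set n.-tuple bool}) : bool :=
  [forall x in C, forall y in C, (x != y) ==> (d <= hamming x y)].

Definition A (n d : nat) : nat :=
  \max_(C : {set n.-tuple bool} | code_min_dist d C) #|C|.

(* Main.v *)
Require Import Defs.
From mathcomp Require Import all_boot.
From mathcomp Require Import zify boolp.
From HB Require Import structures.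

(* If u and v are both in M, or both outside M, and lie at distance at least 2,
   then the first step of a free geodesic from u to v leaves M. This local
   condition passes to subcubes and is invariant under automorphisms, and in
   subcubes of dimension at most 4 it leaves only 13, 81 and 1297 subsets of Q_2,
   Q_3 and Q_4. The bounds 10 for Q_5 and 29 for Q_7 come from an exhaustive
   search that glues subsets of Q_4. In a counterexample in Q_7 the quarter A (a
   Q_5) is chosen of maximal size, at least 8, and then lexicographically maximal
   under automorphisms, which leaves 28 possibilities; the other three quarters are
   enumerated against A. All other upper bounds follow by halving the cube.

   The lower bounds for h <= 7 are explicit sets. For h >= 8 one takes C together
   with its translate along one coordinate, C a code of minimum distance 4: no two
   of these vertices are at distance 2, so geodesics can be routed greedily. *)

Set Implicit Arguments.
Unset Strict Implicit.
Unset Printing Implicit Defensive.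

(** * Subsets of a cube as bit words, and the local test on them *)

Fixpoint flip (i : nat) (u : seq bool) : seq bool :=
  match u, i with
  | [::], _ => [::]
  | b :: u', 0 => ~~ b :: u'
  | b :: u', i'.+1 => b :: flip i' u'
  end.

Definition flips (ds : seq nat) (u : seq bool) : seq bool := foldr flip u ds.

Fixpoint enumc (n : nat) : seq (seq bool) :=
  if n is n'.+1 then
    [seq false :: u | u <- enumc n'] ++ [seq true :: u | u <- enumc n']
  else [:: [::]].

Definition tab (n : nat) (f : pred (seq bool)) : seq bool := map f (enumc n).

Definition cnt (n : nat) (f : pred (seq bool)) : nat := count id (tab n f).

(* [enumc n] lists the vertices in increasing order of [bin 0]. *)
Fixpoint bin (acc : nat) (u : seq bool) : nat :=
  if u is b :: u' then bin (if b then acc.*2.+1 else acc.*2) u' else acc.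

Fixpoint sublists (s : seq nat) : seq (seq nat) :=
  if s is x :: s' then
    let l := sublists s' in l ++ [seq x :: t | t <- l]
  else [:: [::]].

(* Unlike [all] and [has], these stop early under call-by-value; nested [if]s
   replace [&&] and [||] below for the same reason. *)
Fixpoint allc (T : Type) (p : T -> bool) (s : seq T) : bool :=
  if s is x :: s' then (if p x then allc p s' else false) else true.

Fixpoint hasc (T : Type) (p : T -> bool) (s : seq T) : bool :=
  if s is x :: s' then (if p x then true else hasc p s') else false.

Definition get (w u : seq bool) : bool := nth false w (bin 0 u).

(** A violation of the local condition: [u] and the vertex opposite to it in the face spanned by
    [ds] agree, but every first step of a geodesic between them lands in the set. *)
Definition blocked (w u : seq bool) (ds : seq nat) : bool :=
  if allc (fun i => get w (flip i u)) ds
  then eqb (get w u) (get w (flips ds u)) else false.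

Definition dirs (n : nat) : seq (seq nat) :=
  [seq ds <- sublists (iota 0 n) | 1 < size ds].

Definition valid (n : nat) (w : seq bool) : bool :=
  let dd := dirs n in
  allc (fun u => allc (fun ds => ~~ blocked w u ds) dd) (enumc n).

Definition extend (n : nat) (l : seq (seq bool)) : seq (seq bool) :=
  [seq w <- [seq a ++ b | a <- l, b <- l] | valid n w].

(** The words of length 2 are the subsets of Q_1, where the local condition is void because no two
    vertices have distance 2. *)
Definition w1 : seq (seq bool) := enumc 2.
Definition w2 := extend 2 w1.
Definition w3 := extend 3 w2.
Definition w4 := extend 4 w3.

(* The trie of the 16-bit words of Q_4 decides compatibility of cells: Q_4-faces
   which meet two, four or eight cells are concatenations of slices of them. *)
Inductive trie := Dead | Leaf | Fork of trie & trie.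

Fixpoint tadd (w : seq bool) (t : trie) : trie :=
  match w with
  | [::] => Leaf
  | b :: w' =>
    match t with
    | Fork x y => if b then Fork x (tadd w' y) else Fork (tadd w' x) y
    | _ => if b then Fork Dead (tadd w' Dead) else Fork (tadd w' Dead) Dead
    end
  end.

Fixpoint walk (t : trie) (w : seq bool) : trie :=
  match w with
  | [::] => t
  | b :: w' => match t with Fork x y => walk (if b then y else x) w' | _ => Dead end
  end.

Definition live (t : trie) : bool := if t is Dead then false else true.

Definition trie_of (ws : seq (seq bool)) : trie := foldr tadd Dead ws.

Definition t4 := trie_of w4.

Fixpoint walks (ts : seq trie) (ws : seq (seq bool)) : seq trie :=
  match ts, ws with
  | t :: ts', w :: ws' => walk t w :: walks ts' ws'
  | _, _ => [::]
  end.

Fixpoint lives (ts : seq trie) (ws : seq (seq bool)) : bool :=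
  match ts, ws with
  | t :: ts', w :: ws' => if live (walk t w) then lives ts' ws' else false
  | _, _ => true
  end.

(* [None] marks a free coordinate. *)
Fixpoint pats (n d : nat) : seq (seq (option bool)) :=
  if n is n'.+1 then
    (if d is d'.+1 then [seq None :: p | p <- pats n' d'] else [::]) ++
    [seq Some false :: p | p <- pats n' d] ++ [seq Some true :: p | p <- pats n' d]
  else if d is 0 then [:: [::]] else [::].

Fixpoint fill (p : seq (option bool)) (u : seq bool) : seq bool :=
  match p with
  | [::] => [::]
  | Some b :: p' => b :: fill p' u
  | None :: p' => if u is b :: u' then b :: fill p' u' else [::]
  end.

Definition pos (n d : nat) : seq (seq nat) :=
  [seq [seq bin 0 (fill p u) | u <- enumc d] | p <- pats n d].

Definition slices (ps : seq (seq nat)) (w : seq bool) : seq (seq bool) :=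
  [seq [seq nth false w i | i <- p] | p <- ps].

(* A subset of Q_4, with its Q_3-slices and Q_2-slices computed once. *)
Record node := Node {
  wd : seq bool; sz : nat; s3 : seq (seq bool); s2 : seq (seq bool) }.

Definition mknode (p3 p2 : seq (seq nat)) (w : seq bool) : node :=
  Node w (count id w) (slices p3 w) (slices p2 w).

Definition nodes : seq node :=
  let p3 := pos 4 3 in let p2 := pos 4 2 in [seq mknode p3 p2 w | w <- w4].

Definition row3 (P : node) := map (walk t4) (s3 P).
Definition row2 (P : node) := map (walk t4) (s2 P).

(** A Q_4-face of a Q_5 that meets both halves is a Q_3-face times an edge, so two halves are glued
    when all concatenations of parallel Q_3-slices lie in the trie. *)
Definition nb (P : node) : seq node :=
  let r := row3 P in filter (fun Q => lives r (s3 Q)) nodes.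

Fixpoint ltw (v w : seq bool) : bool :=
  match v, w with
  | b :: v', c :: w' => if b then (if c then ltw v' w' else false)
                        else (if c then true else ltw v' w')
  | _, _ => false
  end.

Definition act (g : seq nat * seq bool) (u : seq bool) : seq bool :=
  [seq nth false u x.1 (+) x.2 | x <- zip g.1 g.2].

Definition perms (n : nat) (gs : seq (seq nat * seq bool)) : seq (seq nat) :=
  [seq [seq bin 0 (act g u) | u <- enumc n] | g <- gs].

Definition lexmax (ps : seq (seq nat)) (w : seq bool) : bool :=
  allc (fun p => ~~ ltw w [seq nth false w i | i <- p]) ps.

Local Notation T := true.
Local Notation F := false.

(* Signed permutations picked greedily so that few words are [lexmax]; any
   lists of signed permutations would be sound here. *)
Definition h4 : seq (seq nat * seq bool) :=
  [:: ([:: 1; 2; 3; 0], [:: F; F; F; F]);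
      ([:: 0; 1; 2; 3], [:: F; F; F; T]);
      ([:: 1; 2; 0; 3], [:: F; F; F; F]);
      ([:: 1; 0; 2; 3], [:: F; F; F; F]);
      ([:: 0; 1; 3; 2], [:: F; F; F; F]);
      ([:: 0; 1; 2; 3], [:: F; T; T; T]);
      ([:: 0; 2; 1; 3], [:: F; F; F; T]);
      ([:: 0; 2; 1; 3], [:: F; F; F; F]);
      ([:: 1; 0; 3; 2], [:: F; F; F; F])].

Definition h5 : seq (seq nat * seq bool) :=
  [:: ([:: 1; 0; 2; 3; 4], [:: F; F; F; F; F]);
      ([:: 0; 2; 1; 4; 3], [:: F; F; F; F; F]);
      ([:: 0; 1; 3; 2; 4], [:: F; F; F; F; F]);
      ([:: 3; 1; 4; 0; 2], [:: F; F; T; F; T]);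
      ([:: 2; 4; 0; 3; 1], [:: F; F; F; T; F]);
      ([:: 3; 0; 1; 2; 4], [:: T; T; T; T; T]);
      ([:: 0; 1; 3; 2; 4], [:: F; F; F; F; T]);
      ([:: 1; 0; 2; 4; 3], [:: F; F; F; F; F]);
      ([:: 1; 0; 3; 2; 4], [:: F; F; F; F; T]);
      ([:: 0; 1; 2; 4; 3], [:: F; F; F; F; F]);
      ([:: 0; 1; 2; 3; 4], [:: T; T; T; F; T])].

(** * The exhaustive search *)

Definition c4 : seq node :=
  let ps := perms 4 h4 in filter (fun P => lexmax ps (wd P)) nodes.

Definition sz2 (A : node * node) := sz A.1 + sz A.2.

(** Maximality of a word under automorphisms passes to its first half, so the first half is filtered
    by [c4] before any second half is tried. *)
Definition c5 : seq (node * node) :=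
  let ps := perms 5 h5 in
  flatten [seq [seq (P, X) | X <- nb P &
    if Nat.leb 8 (sz P + sz X) then lexmax ps (wd P ++ wd X) else false] | P <- c4].

(** [r] holds tries already walked along the Q_2-slices of the two cells that complete [X] and [Y]
    to a square. Where [hi - sz X] truncates to 0, a pair that is too large may survive; this is
    harmless, since only completeness of the list matters. *)
Definition pairs (lo hi : nat) (l1 l2 : seq node) (r : seq trie) : seq (node * node) :=
  flatten [seq let rx := row3 X in let r' := walks r (s2 X) in
     let l := lo - sz X in let h := hi - sz X in
     [seq (X, Y) | Y <- l2 &
       if Nat.leb l (sz Y) then
         if Nat.leb (sz Y) h then
           if lives rx (s3 Y) then lives r' (s2 Y) else false
         else false
       else false] | X <- l1].

(** A Q_4-face that meets all eight cells of a Q_7 is an edge of a cell times a 3-cube, so its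
    16-bit word consists of eight slices of length 2. *)
Definition cube (P1 P2 X1 X2 Y1 Y2 Z1 Z2 : node) : bool :=
  let sl := fun P => slices (pos 4 1) (wd P) in
  lives (walks (walks (walks (walks (walks (walks
    (map (walk t4) (sl P1)) (sl P2)) (sl X1)) (sl X2)) (sl Y1)) (sl Y2)) (sl Z1)) (sl Z2).

(* The quarters of a subset of Q_7 are A = 00, C = 01, E = 10, G = 11, so C and E
   are adjacent to both A and G; q is the maximal size of a quarter. *)
Definition refuted_corner (q : nat) (A C : node * node) (r1 r2 : seq trie)
    (es gs : seq (node * node)) : bool :=
  allc (fun G =>
    let lo := 30 - (q + sz2 C + sz2 G) in
    let r1' := walks r1 (s2 G.1) in let r2' := walks r2 (s2 G.2) in
    allc (fun E =>
      if Nat.leb lo (sz2 E) then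
        if lives r1' (s2 E.1) then
          if lives r2' (s2 E.2) then ~~ cube C.1 C.2 A.1 A.2 G.1 G.2 E.1 E.2
          else true
        else true
      else true) es) gs.

(** One list [L] serves for C and E, both adjacent to A. With e <= c, g <= q and a total of at least
    30 one gets e >= 30 - (2q + c), hence the same bound for c, and g >= 30 - (q + 2c). *)
Definition refuted_pair (A C : node * node) (L : seq (node * node)) : bool :=
  let q := sz2 A in let c := sz2 C in let lo := 30 - (q + q + c) in
  if Nat.leb lo c then
    let rac1 := walks (row2 A.1) (s2 C.1) in let rac2 := walks (row2 A.2) (s2 C.2) in
    let es := filter (fun E : node * node => let e := sz2 E in
      if Nat.leb e c then
        if Nat.leb lo e then
          if lives rac1 (s2 E.1) then lives rac2 (s2 E.2) else false
        else false
      else false) L in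
    if es is [::] then true else
    let rc1 := row2 C.1 in let rc2 := row2 C.2 in
    let rca1 := walks rc1 (s2 A.1) in let rca2 := walks rc2 (s2 A.2) in
    let gs := pairs (30 - (q + c + c)) q
                (filter (fun X => lives rca1 (s2 X)) (nb C.1))
                (filter (fun X => lives rca2 (s2 X)) (nb C.2)) (walks rc1 (s2 C.2)) in
    refuted_corner q A C rca1 rca2 es gs
  else true.

(** The answer is negative when [q] exceeds 10, so that a successful run also proves the bound for
    Q_5. *)
Definition refuted (A : node * node) : bool :=
  let q := sz2 A in
  let L := pairs 0 q (nb A.1) (nb A.2) (walks (row2 A.1) (s2 A.2)) in
  if Nat.leb q 10 then allc (fun C => refuted_pair A C L) L else false.

(** * Elementary facts on flips and enumerations *)

Lemma allcE (T : Type) (p : T -> bool) s : allc p s = all p s.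
Proof. by elim: s => //= x s ->; case: (p x). Qed.

Lemma hascE (T : Type) (p : T -> bool) s : hasc p s = has p s.
Proof. by elim: s => //= x s ->; case: (p x). Qed.

Lemma lebE m n : Nat.leb m n = (m <= n).
Proof. by elim: m n => [|m IH] [|n] //=. Qed.

Lemma size_flip i u : size (flip i u) = size u.
Proof. by elim: u i => [|b u IH] [|i] //=; rewrite IH. Qed.

Lemma size_flips ds u : size (flips ds u) = size u.
Proof. by elim: ds => //= i ds IH; rewrite size_flip. Qed.

Lemma flipK i : involutive (flip i).
Proof. by move=> u; elim: u i => [|b u IH] [|i] //=; rewrite ?negbK ?IH. Qed.

Lemma flipC i j u : flip i (flip j u) = flip j (flip i u).
Proof. by elim: u i j => [|b u IH] [|i] [|j] //=; rewrite IH. Qed.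

Lemma nth_flip i j u :
  j < size u -> nth false (flip i u) j = nth false u j (+) (j == i).
Proof.
elim: u i j => [|b u IH] [|i] [|j] //= Hj; rewrite ?addbT ?addbF //.
by rewrite IH.
Qed.

Lemma nth_flips ds j u : uniq ds -> j < size u ->
  nth false (flips ds u) j = nth false u j (+) (j \in ds).
Proof.
elim: ds => [|i ds IH] /=; first by rewrite addbF.
move=> /andP [ni uds] Hj; rewrite nth_flip ?size_flips // IH // in_cons -addbA.
by case: (j =P i) => [->|]; rewrite ?(negbTE ni) ?addbF.
Qed.

Lemma flips_flip ds i u : flips ds (flip i u) = flip i (flips ds u).
Proof. by elim: ds => //= j ds ->; rewrite flipC. Qed.

Lemma flips_rem ds i u : i \in ds -> flips (rem i ds) (flip i u) = flips ds u.
Proof.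
rewrite flips_flip; elim: ds => //= j ds IH; rewrite in_cons.
by case: (j =P i) => [-> //|/eqP ne /orP [/eqP ji|/IH]];
  [rewrite ji eqxx in ne | rewrite /= flipC => ->].
Qed.

Lemma mem_enumc n u : (u \in enumc n) = (size u == n).
Proof.
elim: n u => [|n IH] u /=; first by case: u.
have inj b : injective (cons b : seq bool -> seq bool) by move=> x y [].
rewrite mem_cat; case: u => [|b u] /=.
  by apply/idP => /orP [] /mapP [].
rewrite eqSS -IH; case: b.
  by rewrite (mem_map (inj true)); case: mapP => // [[x _ []]].
by rewrite (mem_map (inj false)); case: mapP => [[x _ []]|]; rewrite ?orbF.
Qed.

Lemma enumc_uniq n : uniq (enumc n).
Proof.
elim: n => //= n IH.
rewrite cat_uniq !map_inj_uniq ?IH /= ?andbT; try by move=> x y [].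
by apply/hasPn => _ /mapP [x _ ->]; apply/mapP => [[y _ []]].
Qed.

Lemma size_enumc n : size (enumc n) = 2 ^ n.
Proof. by elim: n => //= n IH; rewrite size_cat !size_map IH expnS mul2n addnn. Qed.

Lemma tabS n f : tab n.+1 f = tab n (f \o cons false) ++ tab n (f \o cons true).
Proof. by rewrite /tab /= map_cat -!map_comp. Qed.

Lemma cntS n f : cnt n.+1 f = cnt n (f \o cons false) + cnt n (f \o cons true).
Proof. by rewrite /cnt tabS count_cat. Qed.

Lemma eq_tab n f g : (forall u, size u = n -> f u = g u) -> tab n f = tab n g.
Proof. by move=> fg; apply/eq_in_map => u; rewrite mem_enumc => /eqP /fg. Qed.

Lemma size_tab n f : size (tab n f) = 2 ^ n.
Proof. by rewrite size_map size_enumc. Qed.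

Lemma bin_acc a u : bin a u = a * 2 ^ size u + bin 0 u.
Proof.
elim: u a => [|b u IH] a /=; first by rewrite muln1 addn0.
by case: b => /=; rewrite (IH _) [in RHS](IH _) ?mul0n; rewrite expnS; nia.
Qed.

Lemma bin_lt u : bin 0 u < 2 ^ size u.
Proof. by elim: u => //= b u IH; case: b; rewrite bin_acc expnS; lia. Qed.

Lemma nth_enumc u : nth [::] (enumc (size u)) (bin 0 u) = u.
Proof.
elim: u => //= b u IH; rewrite nth_cat size_map size_enumc.
have lt := bin_lt u; have sz := size_enumc (size u).
case: b; rewrite bin_acc /=.
  by rewrite ifN ?mul1n ?addKn ?(nth_map [::]) ?IH ?sz //; lia.
by rewrite mul0n add0n lt (nth_map [::]) ?IH ?sz.
Qed.

Lemma get_tab n f u : size u = n -> get (tab n f) u = f u.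
Proof. by move=> <-; rewrite /get (nth_map [::]) ?nth_enumc ?size_enumc ?bin_lt. Qed.

(* The consequence of dual mutual-visibility that drives all upper bounds: the
   first step of a free geodesic leaves [f]. *)
Definition starred (n : nat) (f : pred (seq bool)) : Prop :=
  forall u ds, size u = n -> uniq ds -> {in ds, forall i, i < n} -> 1 < size ds ->
  f u = f (flips ds u) -> has (fun i => ~~ f (flip i u)) ds.

(** * Isomorphisms of Q_m onto faces of Q_n, with [sigma] the induced map of directions *)

Definition embedding (m n : nat) (phi : seq bool -> seq bool) : Prop :=
  exists sigma : nat -> nat,
  [/\ forall u, size u = m -> size (phi u) = n,
      forall i, i < m -> sigma i < n,
      {in gtn m &, injective sigma},
      forall u i, size u = m -> i < m -> phi (flip i u) = flip (sigma i) (phi u) &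
      {in [pred u | size u == m] &, injective phi}].

(** Directions are carried along [sigma], so the condition at a face of Q_m is an instance of the
    condition at its image. *)
Lemma starred_embedding m n phi f :
  embedding m n phi -> starred n f -> starred m (f \o phi).
Proof.
move=> [sg [szp sgl sgi comm _]] sf u ds su uds lds lt1.
have comms es : {in es, forall i, i < m} ->
    phi (flips es u) = flips (map sg es) (phi u).
  elim: es => //= i es IH les.
  rewrite comm ?size_flips ?IH // => [j je|]; last by apply: les; rewrite mem_head.
  by apply: les; rewrite in_cons je orbT.
rewrite /= comms // => e.
have/hasP [_ /mapP [i ids ->] ni] :
    has (fun i => ~~ f (flip i (phi u))) (map sg ds).
  apply: sf; rewrite ?size_map ?szp //.
    by rewrite map_inj_in_uniq // => i j /lds im /lds jm; apply: sgi.
  by move=> _ /mapP [i /lds im ->]; apply: sgl.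
by apply/hasP; exists i; rewrite //= comm ?lds.
Qed.

Lemma embedding_id n : embedding n n id.
Proof. by exists id; split. Qed.

Lemma embedding_comp m n p phi psi :
  embedding m n phi -> embedding n p psi -> embedding m p (psi \o phi).
Proof.
move=> [s [s1 s2 s3 s4 s5]] [t [t1 t2 t3 t4 t5]]; exists (t \o s); split=> /=.
- by move=> u /s1 /t1.
- by move=> i /s2 /t2.
- by move=> i j im jm /t3 e; apply: s3 => //; apply: e; rewrite inE; apply: s2.
- by move=> u i su im; rewrite s4 // t4 ?s1 ?s2.
- move=> u v su sv /t5 e; apply: s5 => //; apply: e; rewrite inE s1 //; exact/eqP.
Qed.

Lemma embedding_cons b n : embedding n n.+1 (cons b).
Proof. by exists S; split=> // [u <- //|i j _ _ []|u v _ _ []]. Qed.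

Definition liftc (phi : seq bool -> seq bool) (u : seq bool) : seq bool :=
  if u is b :: u' then b :: phi u' else [::].

Lemma embedding_lift m n phi :
  embedding m n phi -> embedding m.+1 n.+1 (liftc phi).
Proof.
move=> [s [s1 s2 s3 s4 s5]]; exists (fun i => if i is i'.+1 then (s i').+1 else 0); split.
- by case=> //= b u [/s1 ->].
- by case=> // i; apply: s2.
- by move=> [|i] [|j] // im jm [e]; congr S; apply: s3.
- by move=> [|b u] [|i] //= [su] im; rewrite s4.
- move=> [|a u] [|b v] //= su sv [-> e]; congr cons; exact: s5.
Qed.

Lemma embedding_fill n d p : p \in pats n d -> embedding d n (fill p).
Proof.
elim: n d p => [|n IH] d p /=.
  case: d => // /[!inE] /eqP ->; exists id; split=> //.
  by move=> u v /eqP/size0nil -> /eqP/size0nil ->.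
rewrite !mem_cat => /or3P [|/mapP [q /IH eq ->]|/mapP [q /IH eq ->]].
- case: d => // d /mapP [q /IH eq ->].
  have [s [s1 s2 s3 s4 s5]] := embedding_lift eq; exists s.
  by split.
- exact: embedding_comp eq (embedding_cons _ _).
- exact: embedding_comp eq (embedding_cons _ _).
Qed.

Lemma embedding_flip i n : embedding n n (flip i).
Proof.
exists id; split=> // [u <-|u j _ _|u v _ _]; first exact: size_flip.
  exact: flipC.
exact: can_inj (flipK i) _ _.
Qed.

Definition swap (u : seq bool) : seq bool :=
  if u is a :: b :: u' then b :: a :: u' else u.

Lemma embedding_swap n : embedding n.+2 n.+2 swap.
Proof.
exists (fun i => if i is i'.+2 then i else 1 - i); split=> //.
- by case=> [|a [|b u]].
- by case=> [|[|i]].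
- by case=> [|[|i]] [|[|j]].
- by case=> [|a [|b u]] // [|[|i]].
- by move=> [|a [|b u]] // [|c [|d v]] //= _ _ [-> -> ->].
Qed.

Definition signed_perm (n : nat) (g : seq nat * seq bool) : bool :=
  perm_eq g.1 (iota 0 n) && (size g.2 == n).

Lemma embedding_act n g : signed_perm n g -> embedding n n (act g).
Proof.
case: g => p s /andP [/= pp /eqP ss].
have sp : size p = n by rewrite (perm_size pp) size_iota.
have up : uniq p by rewrite (perm_uniq pp) iota_uniq.
have mp i : (i \in p) = (i < n) by rewrite (perm_mem pp) mem_iota.
have sa u : size (act (p, s) u) = n.
  by rewrite size_map size_zip sp ss minnn.
have na u j : j < n ->
    nth false (act (p, s) u) j = nth false u (nth 0 p j) (+) nth false s j.
  move=> jn; rewrite (nth_map (0, false)) ?size_zip ?sp ?ss ?minnn //.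
  by rewrite nth_zip ?sp ?ss.
(* Coordinate [j] of the image reads coordinate [nth 0 p j], so flipping coordinate [i] is felt at
   the position of [i] in [p]. *)
exists (index^~ p); split=> //.
- by move=> i im; rewrite -sp index_mem mp.
- by move=> i j im jm e; rewrite -(nth_index 0 (_ : i \in p)) ?mp // e nth_index ?mp.
- move=> u i su im; apply: (@eq_from_nth _ false); first by rewrite size_flip !sa.
  move=> j; rewrite sa => jn; rewrite nth_flip ?sa // !na // nth_flip; last first.
    by rewrite su -mp mem_nth ?sp.
  rewrite addbAC; congr (_ (+) _).
  apply/eqP/eqP => [<-|->]; first by rewrite index_uniq ?sp.
  by rewrite nth_index ?mp.
- move=> u v /eqP su /eqP sv e; apply: (@eq_from_nth _ false); first by rewrite su.
  move=> i; rewrite su -mp => ip; have im : index i p < n by rewrite -sp index_mem.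
  by move/(congr1 (fun x => nth false x (index i p))): e; rewrite !na // nth_index // => /addIb.
Qed.

Lemma cnt_embedding n phi f : embedding n n phi -> cnt n (f \o phi) = cnt n f.
Proof.
move=> [_ [s1 _ _ _ inj]].
rewrite /cnt /tab map_comp; apply/permP/perm_map.
have um : uniq (map phi (enumc n)).
  rewrite map_inj_in_uniq ?enumc_uniq // => u v.
  by rewrite mem_enumc => su; rewrite mem_enumc => sv; apply: inj.
apply: uniq_perm; rewrite ?enumc_uniq //.
(* Pigeonhole: a duplicate-free list inside [enumc n] of the same length has the same elements. *)
apply: (uniq_min_size um _ _).2; last by rewrite size_map.
by move=> _ /mapP [u + ->]; rewrite !mem_enumc => /eqP/s1 ->.
Qed.

(** * Completeness of the lists of words *)

Lemma filter_sublists (P : pred nat) s : filter P s \in sublists s.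
Proof.
elim: s => //= x s IH; rewrite mem_cat; case: (P x); last by rewrite IH.
by rewrite map_f ?orbT.
Qed.

Lemma sublists_subseq s t : t \in sublists s -> subseq t s.
Proof.
elim: s t => [|x s IH] t /=; first by rewrite inE => /eqP ->.
rewrite mem_cat => /orP [/IH ts|/mapP [r /IH rs ->]]; last by rewrite /= eqxx.
exact: subseq_trans ts (subseq_cons _ _).
Qed.

Lemma dirsP n ds : ds \in dirs n ->
  [/\ uniq ds, {in ds, forall i, i < n} & 1 < size ds].
Proof.
rewrite mem_filter => /andP [lt1 /sublists_subseq sub]; split=> //.
  exact: subseq_uniq sub (iota_uniq _ _).
by move=> i /(mem_subseq sub); rewrite mem_iota.
Qed.

Lemma valid_tab n f : starred n f -> valid n (tab n f).
Proof.
move=> sf; rewrite /valid allcE; apply/allP => u; rewrite mem_enumc => /eqP su.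
rewrite allcE; apply/allP => ds /dirsP [uds lds lt1]; rewrite /blocked allcE.
rewrite !get_tab ?size_flips //; case: allP => // full.
apply/negP => /eqP e; have/hasP [i ids] := sf u ds su uds lds lt1 e.
by have := full i ids; rewrite get_tab ?size_flip // => ->.
Qed.

Lemma mem_extend n l :
  (forall f, starred n f -> tab n f \in l) ->
  forall f, starred n.+1 f -> tab n.+1 f \in extend n.+1 l.
Proof.
move=> lP f sf; rewrite mem_filter valid_tab //= tabS; apply/allpairsP.
exists (tab n (f \o cons false), tab n (f \o cons true)).
by split; rewrite //= lP //; apply: starred_embedding sf; apply: embedding_cons.
Qed.

Lemma mem_w1 f : tab 1 f \in w1.
Proof. by rewrite mem_enumc size_tab. Qed.

Lemma mem_w2 f : starred 2 f -> tab 2 f \in w2.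
Proof. by apply: mem_extend => g _; apply: mem_w1. Qed.

Lemma mem_w3 f : starred 3 f -> tab 3 f \in w3.
Proof. by apply: mem_extend => g; apply: mem_w2. Qed.

Lemma mem_w4 f : starred 4 f -> tab 4 f \in w4.
Proof. by apply: mem_extend => g; apply: mem_w3. Qed.

Lemma size_extend n l k :
  {in l, forall w, size w = k} -> {in extend n l, forall w, size w = k + k}.
Proof.
move=> sl w; rewrite mem_filter => /andP [_ /allpairsP [[a b] /= [al bl ->]]].
by rewrite size_cat !sl.
Qed.

Lemma size_w4 : {in w4, forall w, size w = 16}.
Proof.
apply: (@size_extend 4 _ 8); apply: (@size_extend 3 _ 4); apply: (@size_extend 2 _ 2).
by move=> w; rewrite mem_enumc => /eqP.
Qed.

(** * Tries as membership tests *)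

Lemma walk_dead w : walk Dead w = Dead.
Proof. by case: w. Qed.

Lemma walk_cat t v w : walk t (v ++ w) = walk (walk t v) w.
Proof. by elim: v t => [//|b v IH] [||x y] //=; case: (w). Qed.

Lemma live_walk t v w : live (walk (walk t v) w) -> live (walk t v).
Proof. by case: (walk t v) => //; rewrite walk_dead. Qed.

(** Prefixes of stored words are live too, so a walk decides membership only at full length. On
    shorter words it is the test that prunes partial gluings. *)
Lemma live_tadd v w t : size v = size w ->
  live (walk (tadd v t) w) = (v == w) || live (walk t w).
Proof.
elim: v w t => [|b v IH] [|c w] t //= [e].
rewrite eqseq_cons; case: t => [||x y]; case: b c => [] [] //=;
  by rewrite ?IH ?walk_dead //; case: (w).
Qed.

Lemma live_trie_of n ws w : {in ws, forall v, size v = n} -> size w = n ->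
  live (walk (trie_of ws) w) = (w \in ws).
Proof.
elim: ws => [|v ws IH] sws sw; first by rewrite walk_dead.
rewrite [trie_of _]/(tadd v (trie_of ws)) live_tadd; last by rewrite sw sws ?mem_head.
rewrite in_cons eq_sym IH // => x xs.
by rewrite sws // in_cons xs orbT.
Qed.

Lemma live_tab f : starred 4 f -> live (walk t4 (tab 4 f)).
Proof. by move=> sf; rewrite (live_trie_of size_w4) ?mem_w4 ?size_tab. Qed.

#[local] Opaque t4 nodes.

Lemma livesE (I : Type) F W (ps : seq I) :
  lives (map F ps) (map W ps) = all (fun p => live (walk (F p) (W p))) ps.
Proof. by elim: ps => //= p ps ->; case: live. Qed.

Lemma walksE (I : Type) F W (ps : seq I) :
  walks (map F ps) (map W ps) = [seq walk (F p) (W p) | p <- ps].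
Proof. by elim: ps => //= p ps ->. Qed.

Lemma lives_square (I : Type) t (F G H K : I -> seq bool) ps :
  lives (walks (walks (map (walk t) (map F ps)) (map G ps)) (map H ps)) (map K ps) =
  all (fun p => live (walk t (F p ++ G p ++ H p ++ K p))) ps.
Proof.
by rewrite -map_comp !walksE livesE; apply: eq_all => p /=; rewrite !walk_cat.
Qed.

Lemma lives_cube (I : Type) t (F0 F1 F2 F3 F4 F5 F6 F7 : I -> seq bool) ps :
  lives (walks (walks (walks (walks (walks (walks (map (walk t) (map F0 ps)) (map F1 ps))
    (map F2 ps)) (map F3 ps)) (map F4 ps)) (map F5 ps)) (map F6 ps)) (map F7 ps) =
  all (fun p => live (walk t (F0 p ++ F1 p ++ F2 p ++ F3 p ++ F4 p ++ F5 p ++ F6 p ++ F7 p))) ps.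
Proof.
by rewrite -map_comp !walksE livesE; apply: eq_all => p /=; rewrite !walk_cat.
Qed.

(** A dead walk stays dead. The sizes matter because [lives] stops at the end of the shorter
    list. *)
Lemma lives_walks ts v w : lives (walks ts v) w -> size w = size v -> lives ts v.
Proof.
elim: ts v w => [|t ts IH] [|a v] [|b w] //=.
case: ifP => // /live_walk -> l [e]; exact: IH l e.
Qed.

(** * Cells of a cube and the faces they share *)

Definition node_code (P : node) := (wd P, sz P, s3 P, s2 P).

(** This provides the decidable equality on [node] that membership in lists of nodes requires. *)
Lemma node_codeK :
  cancel node_code (fun x => let: (w, k, t3, t2) := x in Node w k t3 t2).
Proof. by case. Qed.

HB.instance Definition _ := Equality.copy node (can_type node_codeK).

Lemma slices_tab n d f :
  slices (pos n d) (tab n f) = [seq tab d (f \o fill p) | p <- pats n d].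
Proof.
rewrite /slices /pos -map_comp; apply/eq_in_map => p /embedding_fill [s [szp _ _ _ _]].
rewrite /= -map_comp; apply/eq_in_map => u; rewrite mem_enumc => /eqP /szp sp /=.
exact: get_tab.
Qed.

Definition cell (f : pred (seq bool)) (v : seq bool) : node :=
  mknode (pos 4 3) (pos 4 2) (tab 4 (fun u => f (v ++ u))).

Lemma s3_cell f v :
  s3 (cell f v) = [seq tab 3 (fun u => f (v ++ fill p u)) | p <- pats 4 3].
Proof. exact: slices_tab. Qed.

Lemma s2_cell f v :
  s2 (cell f v) = [seq tab 2 (fun u => f (v ++ fill p u)) | p <- pats 4 2].
Proof. exact: slices_tab. Qed.

Lemma sz2_cell f v :
  sz2 (cell f (rcons v false), cell f (rcons v true)) = cnt 5 (fun u => f (v ++ u)).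
Proof. by rewrite cntS; congr (_ + _); congr count; apply: eq_tab => u _ /=; rewrite cat_rcons. Qed.

Lemma cell_nodes f : starred 4 f -> cell f [::] \in nodes.
Proof. by move=> sf; apply: (map_f (mknode _ _)); apply: mem_w4. Qed.

(** The relevant faces keep the leading coordinate free and restrict the last four; squares and
    cubes of cells are treated alike, with two and three leading coordinates. *)
Lemma cell_pair f : starred 5 f ->
  lives (row3 (cell f [:: false])) (s3 (cell f [:: true])).
Proof.
move=> sf; rewrite /row3 !s3_cell -map_comp livesE; apply/allP => p pp.
have := live_tab (starred_embedding (embedding_lift (embedding_fill pp)) sf).
(* Abstracting [t4] leaves no trie that conversion could try to evaluate. *)
by move: t4 => t; rewrite tabS walk_cat.
Qed.

Lemma cell_square f : starred 6 f ->
  lives (walks (walks (row2 (cell f [:: false; false])) (s2 (cell f [:: false; true])))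
    (s2 (cell f [:: true; false]))) (s2 (cell f [:: true; true])).
Proof.
move=> sf; rewrite /row2 !s2_cell lives_square; apply/allP => p pp.
have emb := embedding_lift (embedding_lift (embedding_fill pp)).
have := live_tab (starred_embedding emb sf).
by move: t4 => t; rewrite !tabS -!catA.
Qed.

Lemma cell_triple f : starred 6 f ->
  lives (walks (row2 (cell f [:: false; false])) (s2 (cell f [:: false; true])))
    (s2 (cell f [:: true; false])).
Proof. by move=> /cell_square/lives_walks; apply; rewrite !s2_cell !size_map. Qed.

Lemma cell_cube f : starred 7 f ->
  cube (cell f [:: false; false; false]) (cell f [:: false; false; true])
       (cell f [:: false; true; false]) (cell f [:: false; true; true])
       (cell f [:: true; false; false]) (cell f [:: true; false; true])
       (cell f [:: true; true; false]) (cell f [:: true; true; true]).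
Proof.
move=> sf; rewrite /cube !slices_tab lives_cube; apply/allP => p pp.
have emb := embedding_lift (embedding_lift (embedding_lift (embedding_fill pp))).
have := live_tab (starred_embedding emb sf).
by move: t4 => t; rewrite !tabS -!catA.
Qed.

Lemma cell_nb f : starred 5 f -> cell f [:: true] \in nb (cell f [:: false]).
Proof.
move=> sf; rewrite mem_filter cell_pair //=.
exact: cell_nodes (starred_embedding (embedding_cons true 4) sf).
Qed.

Lemma mem_pairs lo hi l1 l2 r X Y : X \in l1 -> Y \in l2 ->
  lo <= sz2 (X, Y) <= hi -> lives (row3 X) (s3 Y) -> lives (walks r (s2 X)) (s2 Y) ->
  (X, Y) \in pairs lo hi l1 l2 r.
Proof.
move=> X1 Y2 /andP [lo_le le_hi] pair square; apply/flatten_mapP; exists X => //.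
apply/mapP; exists Y => //; rewrite mem_filter Y2 !lebE pair square.
rewrite leq_subLR lo_le; suff -> : sz Y <= hi - sz X by [].
by move: le_hi; rewrite /sz2 /=; lia.
Qed.

Lemma cell_pairs f lo hi l1 l2 : starred 6 f ->
  cell f [:: true; false] \in l1 -> cell f [:: true; true] \in l2 ->
  lo <= cnt 5 (fun u => f (true :: u)) <= hi ->
  (cell f [:: true; false], cell f [:: true; true]) \in
    pairs lo hi l1 l2
      (walks (row2 (cell f [:: false; false])) (s2 (cell f [:: false; true]))).
Proof.
move=> sf m1 m2; rewrite -(sz2_cell f [:: true]) => szP.
have pair := cell_pair (starred_embedding (embedding_cons true 5) sf).
exact: mem_pairs m1 m2 szP pair (cell_square sf).
Qed.

(** * Words that are maximal under automorphisms *)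

Lemma ltw_bin v w : size v = size w -> ltw v w -> bin 0 v < bin 0 w.
Proof.
elim: v w => [|b v IH] [|c w] //= [e]; rewrite bin_acc [bin _ w]bin_acc e.
have := bin_lt v; rewrite e.
case: b c => [] [] //=; rewrite ?mul0n ?mul1n ?add0n => lt; first by rewrite ltn_add2l; apply: IH.
  by move=> _; apply: ltn_addr.
exact: IH.
Qed.

Lemma ltw_cat v v' w w' : size v = size w -> ltw v w -> ltw (v ++ v') (w ++ w').
Proof. by elim: v w => [|b v IH] [|c w] //= [e]; case: b c => [] [] //; apply: IH. Qed.

Lemma lexmax_tab n gs f : all (signed_perm n) gs ->
  (forall g, signed_perm n g -> ~~ ltw (tab n f) (tab n (f \o act g))) ->
  lexmax (perms n gs) (tab n f).
Proof.
move=> /allP sg fmax; rewrite /lexmax allcE; apply/allP => _ /mapP [g /sg gP ->].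
rewrite (_ : map _ _ = tab n (f \o act g)) ?fmax //.
rewrite -map_comp; apply/eq_in_map => u; rewrite mem_enumc => /eqP su.
by have [s [szg _ _ _ _]] := embedding_act gP; apply: get_tab; apply: szg.
Qed.

Lemma mem_c5 P X : P \in nodes -> lexmax (perms 4 h4) (wd P) -> X \in nb P ->
  8 <= sz2 (P, X) -> lexmax (perms 5 h5) (wd P ++ wd X) -> (P, X) \in c5.
Proof.
move=> nP maxP nX ge8 maxPX; apply/flatten_mapP; exists P.
  by rewrite mem_filter maxP nP.
by apply/mapP; exists X => //; rewrite mem_filter nX lebE ge8 maxPX.
Qed.

Lemma c5_complete f : starred 5 f -> 8 <= cnt 5 f ->
  (forall phi, embedding 5 5 phi -> bin 0 (tab 5 (f \o phi)) <= bin 0 (tab 5 f)) ->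
  (cell f [:: false], cell f [:: true]) \in c5.
Proof.
move=> sf f8 fmax.
have wE : wd (cell f [:: false]) ++ wd (cell f [:: true]) = tab 5 f by rewrite tabS.
have nlt phi : embedding 5 5 phi -> ~~ ltw (tab 5 f) (tab 5 (f \o phi)).
  by move=> /fmax; apply: contraTN => /ltw_bin; rewrite !size_tab -ltnNge; apply.
apply: mem_c5.
- exact: cell_nodes (starred_embedding (embedding_cons false 4) sf).
(* A signed permutation of the last four coordinates acts on both halves at once, so a larger image
   of the first half would give a larger word for Q_5. *)
- apply: lexmax_tab => // g /embedding_act/embedding_lift/nlt.
  by apply: contraNN => lt; rewrite !tabS; apply: ltw_cat; rewrite ?size_tab.
- exact: cell_nb.
- by rewrite (sz2_cell f [::]).
- by rewrite wE; apply: lexmax_tab => // g /embedding_act/nlt.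
Qed.

(** [P] is a mere proposition, so the attained values of [K] are made decidable by [asbool] before
    the largest is taken. *)
Lemma ex_max (T : Type) (P : T -> Prop) (K : T -> nat) b :
  (exists x, P x) -> (forall x, P x -> K x <= b) ->
  exists2 x, P x & forall y, P y -> K y <= K x.
Proof.
move=> [x Px] Kb; pose Q n := `[< exists2 x, P x & K x = n >].
have exQ : exists n, Q n by exists (K x); apply/asboolP; exists x.
have leQ n : Q n -> n <= b by move=> /asboolP [y /Kb + <-].
have [n /asboolP [y Py <-] maxn] := ex_maxnP exQ leQ.
by exists y => // z Pz; apply: maxn; apply/asboolP; exists z.
Qed.


(** * Soundness of the search, and the bound for Q_5 *)

Lemma refuted_le10 A : refuted A -> sz2 A <= 10.
Proof. by rewrite /refuted lebE; case: leqP. Qed.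

Definition candidates (A : node * node) : seq (node * node) :=
  pairs 0 (sz2 A) (nb A.1) (nb A.2) (walks (row2 A.1) (s2 A.2)).

Lemma refutedP A C :
  refuted A -> C \in candidates A -> refuted_pair A C (candidates A).
Proof. by rewrite /refuted; case: ifP => // _; rewrite allcE => /allP; apply. Qed.

(** The hypotheses are what the filters of the search test, so G and E are reached for this C and
    the negated [cube] test fails on them. *)
Lemma refuted_false A C E G : refuted A ->
  C \in candidates A -> E \in candidates A -> sz2 E <= sz2 C -> sz2 G <= sz2 A ->
  30 <= sz2 A + sz2 C + sz2 E + sz2 G ->
  lives (walks (row2 A.1) (s2 C.1)) (s2 E.1) ->
  lives (walks (row2 A.2) (s2 C.2)) (s2 E.2) ->
  G.1 \in nb C.1 -> G.2 \in nb C.2 -> lives (row3 G.1) (s3 G.2) ->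
  lives (walks (walks (row2 C.1) (s2 C.2)) (s2 G.1)) (s2 G.2) ->
  lives (walks (row2 C.1) (s2 A.1)) (s2 G.1) ->
  lives (walks (row2 C.2) (s2 A.2)) (s2 G.2) ->
  lives (walks (walks (row2 C.1) (s2 A.1)) (s2 G.1)) (s2 E.1) ->
  lives (walks (walks (row2 C.2) (s2 A.2)) (s2 G.2)) (s2 E.2) ->
  cube C.1 C.2 A.1 A.2 G.1 G.2 E.1 E.2 -> False.
Proof.
have bounds q c e g : e <= c -> g <= q -> 30 <= q + c + e + g ->
  [/\ 30 - (q + q + c) <= c, 30 - (q + q + c) <= e, 30 - (q + c + c) <= g &
      30 - (q + c + g) <= e] by move=> *; split; lia.
move=> /refutedP refC /refC {refC}; move: (candidates A) => L.
rewrite /refuted_pair => + EL leEC leGA /(bounds _ _ _ _ leEC leGA) [b1 b2 b3 b4].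
move=> + ace1 ace2 nG1 nG2 gg ccgg cag1 cag2 cage1 cage2 cb.
rewrite lebE b1; set es := filter _ L.
have Ees : E \in es by rewrite mem_filter EL !lebE leEC b2 ace1 ace2.
case: es Ees => [|E0 es'] Ees; first by rewrite in_nil in Ees.
have m1 : G.1 \in [seq X <- nb C.1 | lives (walks (row2 C.1) (s2 A.1)) (s2 X)].
  by rewrite mem_filter cag1 nG1.
have m2 : G.2 \in [seq X <- nb C.2 | lives (walks (row2 C.2) (s2 A.2)) (s2 X)].
  by rewrite mem_filter cag2 nG2.
have szG : 30 - (sz2 A + sz2 C + sz2 C) <= sz2 (G.1, G.2) <= sz2 A.
  by rewrite -surjective_pairing leGA b3.
rewrite /refuted_corner allcE => /allP/(_ _ (mem_pairs m1 m2 szG gg ccgg)).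
rewrite -surjective_pairing allcE => /allP/(_ _ Ees).
by rewrite lebE b4 cage1 cage2 cb.
Qed.

(** The search itself, evaluated by the virtual machine when the kernel checks the proof term. *)
Lemma all_refuted : allc refuted c5 = true.
Proof. vm_cast_no_check (erefl true). Qed.

Lemma c5_refuted A : A \in c5 -> refuted A.
Proof. by move: A; apply/allP; rewrite -allcE; exact: all_refuted. Qed.

#[local] Opaque c5 refuted.

(** A counterexample with the largest word has at least 11 >= 8 elements, hence appears in [c5],
    whose members all have size at most 10. *)
Lemma cnt5_le10 f : starred 5 f -> cnt 5 f <= 10.
Proof.
move=> sf; rewrite leqNgt; apply/negP => f11.
pose P g := starred 5 g /\ 10 < cnt 5 g.
have bnd g : P g -> bin 0 (tab 5 g) <= 2 ^ size (tab 5 g) by move=> _; apply/ltnW/bin_lt.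
have [b bndP] : exists b, forall g, P g -> bin 0 (tab 5 g) <= b.
  by exists (2 ^ (2 ^ 5)) => g /bnd; rewrite size_tab.
have [|g [sg g11] maxg] := ex_max _ bndP; first by exists f.
have gc5 : (cell g [:: false], cell g [:: true]) \in c5.
  apply: (c5_complete sg (leq_trans _ g11)); first by [].
  move=> phi ephi.
  by apply: maxg; split; [apply: starred_embedding sg|rewrite cnt_embedding].
by have := refuted_le10 (c5_refuted gc5); rewrite (sz2_cell g [::]) leqNgt g11.
Qed.

(** * Quarters of Q_7 and the extremal counterexample *)

Definition quarter (a b : bool) (f : pred (seq bool)) : pred (seq bool) :=
  fun u => f [:: a, b & u].

Lemma cnt_quarter f : cnt 7 f = cnt 5 (quarter false false f) +
  cnt 5 (quarter false true f) + cnt 5 (quarter true false f) + cnt 5 (quarter true true f).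
Proof. by rewrite (cntS 6) !(cntS 5) !addnA. Qed.

Lemma sz2_quarter a b f :
  sz2 (cell f [:: a; b; false], cell f [:: a; b; true]) = cnt 5 (quarter a b f).
Proof. exact: (sz2_cell (quarter a b f) [::]). Qed.

Lemma quarter_flip a b f : quarter false false (f \o (if a then flip 0 else id)
  \o (if b then flip 1 else id)) = quarter a b f.
Proof. by case: a b => [] []. Qed.

Section Extremal.

Variable f : pred (seq bool).
Hypothesis sf : starred 7 f.
Hypothesis f30 : 30 <= cnt 7 f.
Hypothesis max_cnt : forall phi, embedding 7 7 phi ->
  cnt 5 (quarter false false (f \o phi)) <= cnt 5 (quarter false false f).
Hypothesis max_bin : forall phi, embedding 5 5 phi ->
  bin 0 (tab 5 (quarter false false f \o phi)) <= bin 0 (tab 5 (quarter false false f)).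
Hypothesis le_quarter :
  cnt 5 (quarter true false f) <= cnt 5 (quarter false true f).

Local Notation pair a b := (cell f [:: a; b; false], cell f [:: a; b; true]).

Lemma max_quarter a b : cnt 5 (quarter a b f) <= cnt 5 (quarter false false f).
Proof.
rewrite -quarter_flip; apply: (max_cnt (phi := (if a then flip 0 else id) \o
                        (if b then flip 1 else id))).
by apply: embedding_comp; [case: b|case: a]; try apply: embedding_flip; apply: embedding_id.
Qed.

Lemma extremal_false : False.
Proof.
have embQ : embedding 5 7 (fun u => [:: false, false & u]).
  exact: embedding_comp (embedding_cons false 5) (embedding_cons false 6).
have ref : refuted (pair false false).
  apply: c5_refuted; apply: (@c5_complete (quarter false false f)); last exact: max_bin.
    exact: starred_embedding embQ sf.
  (* Four quarters of at most 7 elements would give at most 28 < 30, so the largest quarter has at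
     least 8. *)
  have := f30; rewrite cnt_quarter.
  by move: (max_quarter false true) (max_quarter true false) (max_quarter true true); lia.
(* A cell [cell f [:: x; y; z]] is a vertex of a 3-cube; the subscripts name the
   coordinates which each embedding fixes. *)
have emb_yz b k : embedding 5 7 (liftc (cons b \o cons k)).
  apply: embedding_lift; exact: embedding_comp (embedding_cons k 4) (embedding_cons b 5).
have emb_xz a k : embedding 5 7 (cons a \o liftc (cons k)).
  exact: embedding_comp (embedding_lift (embedding_cons k 4)) (embedding_cons a 6).
have emb_xy a b : embedding 5 7 (cons a \o cons b).
  exact: embedding_comp (embedding_cons b 5) (embedding_cons a 6).
have emb_x a : embedding 6 7 (cons a) by apply: embedding_cons.
have emb_y b : embedding 6 7 (liftc (cons b)) by apply/embedding_lift/embedding_cons.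
have emb_z k : embedding 6 7 (liftc (liftc (cons k))).
  by apply/embedding_lift/embedding_lift/embedding_cons.
(* This flip moves C to the corner 00 and A to 01. *)
have embF : embedding 7 7 (liftc (flip 0)) by apply/embedding_lift/embedding_flip.
have sub m phi (e : embedding m 7 phi) := starred_embedding e sf.
have subF m phi (e : embedding m 7 phi) := starred_embedding (embedding_comp e embF) sf.
apply: (@refuted_false (pair false false) (pair false true) (pair true false) (pair true true)).
- exact: ref.
- rewrite /candidates sz2_quarter; apply: (cell_pairs (sub _ _ (emb_x false))).
  + exact: cell_nb (sub _ _ (emb_xz false false)).
  + exact: cell_nb (sub _ _ (emb_xz false true)).
  + exact: max_quarter.
- rewrite /candidates sz2_quarter; apply: (cell_pairs (sub _ _ (emb_y false))).
  + exact: cell_nb (sub _ _ (emb_yz false false)).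
  + exact: cell_nb (sub _ _ (emb_yz false true)).
  + exact: max_quarter.
- by rewrite !sz2_quarter.
- by rewrite !sz2_quarter; apply: max_quarter.
- by rewrite !sz2_quarter -cnt_quarter.
- exact: cell_triple (sub _ _ (emb_z false)).
- exact: cell_triple (sub _ _ (emb_z true)).
- exact: cell_nb (sub _ _ (emb_yz true false)).
- exact: cell_nb (sub _ _ (emb_yz true true)).
- exact: cell_pair (sub _ _ (emb_xy true true)).
- exact: cell_square (sub _ _ (emb_y true)).
- exact: cell_triple (subF _ _ (emb_z false)).
- exact: cell_triple (subF _ _ (emb_z true)).
- exact: cell_square (subF _ _ (emb_z false)).
- exact: cell_square (subF _ _ (emb_z true)).
- exact: cell_cube (subF _ _ (embedding_id 7)).
Qed.

End Extremal.

Lemma cnt7_le29 f : starred 7 f -> cnt 7 f <= 29.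
Proof.
move=> sf; rewrite leqNgt; apply/negP => f30.
pose P g := starred 7 g /\ 29 < cnt 7 g.
pose q := quarter false false.
have [B ltB] : exists B, forall g : pred (seq bool), bin 0 (tab 5 g) < B.
  by exists (2 ^ (2 ^ 5)) => g; have := bin_lt (tab 5 g); rewrite size_tab.
(* As [bin] stays below [B], maximizing [K] maximizes the size of the quarter first and its word
   second. *)
pose K g := cnt 5 (q g) * B + bin 0 (tab 5 (q g)).
have [N leN] : exists N, forall g : pred (seq bool), cnt 5 g <= N.
  by exists (size (enumc 5)) => g; rewrite -(size_map g) count_size.
have Kbnd g : P g -> K g <= N * B + B.
  by move=> _; exact: leq_add (leq_mul (leN _) (leqnn B)) (ltnW (ltB _)).
have [|g [sg g30] maxg] := ex_max _ Kbnd; first by exists f.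
have max_cnt h : P h -> cnt 5 (q h) <= cnt 5 (q g).
  move=> /maxg; rewrite /K leqNgt; apply: contraNleq => lt.
  have := ltB (q h); have := ltB (q g); nia.
have max_bin h : P h -> cnt 5 (q h) = cnt 5 (q g) ->
    bin 0 (tab 5 (q h)) <= bin 0 (tab 5 (q g)).
  by move=> /maxg + e; rewrite /K e leq_add2l.
have Pphi phi : embedding 7 7 phi -> P (g \o phi).
  by move=> e; split; [apply: starred_embedding sg|rewrite cnt_embedding].
(* Stated for every [h] with the same 00-quarter as [g], in order to cover both [g] and its image
   under [swap]. *)
have main h : P h -> q h = q g -> (forall phi, embedding 7 7 phi -> P (h \o phi)) ->
    cnt 5 (quarter true false h) <= cnt 5 (quarter false true h) -> False.
  move=> [sh h30] qh Ph le; apply: (extremal_false sh h30 _ _ le) => phi ephi.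
    by rewrite -/q qh; apply/max_cnt/Ph.
  rewrite -/q qh; have ephi2 := embedding_lift (embedding_lift ephi).
  (* An automorphism of the quarter extends to Q_7 by fixing the first two coordinates, and it
     preserves the size of the quarter. *)
  have -> : q g \o phi = q (h \o liftc (liftc phi)) by rewrite -qh.
  apply: max_bin; first exact: Ph.
  rewrite -[RHS](cnt_embedding _ ephi) -qh; exact: erefl.
have [le|/ltnW le] := leqP (cnt 5 (quarter true false g)) (cnt 5 (quarter false true g)).
  exact: (main g (conj sg g30) erefl Pphi le).
(* Exchanging the first two coordinates interchanges the quarters 01 and 10 and keeps 00. *)
apply: (main (g \o swap) (Pphi _ (embedding_swap 5)) erefl _ le).
by move=> phi e; apply: (Pphi (swap \o phi)); apply: embedding_comp e (embedding_swap 5).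
Qed.

(** * Distances and geodesics in the hypercube *)

Lemma flips_tupleP h ds (t : h.-tuple bool) : size (flips ds t) == h.
Proof. by rewrite size_flips size_tuple. Qed.

Definition tflips h ds (t : h.-tuple bool) : h.-tuple bool := Tuple (flips_tupleP ds t).

Lemma hamming_tflips h ds (u : h.-tuple bool) :
  uniq ds -> {in ds, forall i, i < h} -> hamming u (tflips ds u) = size ds.
Proof.
move=> uds lds; rewrite /hamming cardE -(size_map val); apply/perm_size/uniq_perm => //.
  by rewrite map_inj_uniq ?enum_uniq //; apply: val_inj.
have tn i (t : h.-tuple bool) : tnth t i = nth false t i by apply: tnth_nth.
move=> i; apply/mapP/idP => [[j + ->]|ids].
  rewrite mem_enum inE !tn nth_flips ?size_tuple //.
  by case: (val j \in ds); rewrite ?addbF ?eqxx.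
exists (Ordinal (lds i ids)) => //.
rewrite mem_enum inE !tn nth_flips ?size_tuple ?lds //= ids.
by case: nth.
Qed.

Lemma hamming_triangle h (x y z : h.-tuple bool) :
  hamming x z <= hamming x y + hamming y z.
Proof.
rewrite /hamming -cardsUI; apply: leq_trans (leq_addr _ _); apply/subset_leq_card/subsetP.
by move=> i; rewrite !inE; case: (tnth x i =P tnth y i) => [->|].
Qed.

Lemma hammingC h (x y : h.-tuple bool) : hamming x y = hamming y x.
Proof. by apply: eq_card => i; rewrite !inE eq_sym. Qed.

Lemma hamming_self h (x : h.-tuple bool) : hamming x x = 0.
Proof. by apply/eqP; rewrite cards_eq0; apply/eqP/setP => i; rewrite !inE eqxx. Qed.

Definition diff (u v : seq bool) : seq nat :=
  [seq i <- iota 0 (size u) | nth false u i != nth false v i].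

Lemma uniq_diff u v : uniq (diff u v).
Proof. by rewrite filter_uniq ?iota_uniq. Qed.

Lemma diff_lt u v : {in diff u v, forall i, i < size u}.
Proof. by move=> i; rewrite mem_filter mem_iota => /andP []. Qed.

Lemma flips_diff u v : size u = size v -> flips (diff u v) u = v.
Proof.
move=> e; apply: (@eq_from_nth _ false); first by rewrite size_flips.
move=> i; rewrite size_flips => iu; rewrite nth_flips ?uniq_diff // mem_filter mem_iota iu.
by rewrite andbT; case: nth; case: nth.
Qed.

Lemma hypercube_tflips h i (x : h.-tuple bool) : i < h -> hypercube x (tflips [:: i] x).
Proof. by move=> ih; rewrite /hypercube hamming_tflips // => j /[!inE] /eqP ->. Qed.

Lemma hypercubeP h (x y : h.-tuple bool) :
  hypercube x y -> exists2 i, i < h & y = tflips [:: i] x.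
Proof.
have yE : y = tflips (diff x y) x by apply/val_inj; rewrite /= flips_diff ?size_tuple.
have lds : {in diff x y, forall i, i < h}.
  by move=> i /diff_lt; rewrite size_tuple.
rewrite /hypercube {1}yE hamming_tflips ?uniq_diff //.
case: (diff x y) yE lds => [|i [|]] //= yE lds _; exists i => //.
by apply: lds; rewrite mem_head.
Qed.

Lemma hamming_path h (u : h.-tuple bool) p :
  path (@hypercube h) u p -> hamming u (last u p) <= size p.
Proof.
elim: p u => [|x p IH] u /=; first by rewrite hamming_self.
move=> /andP [/eqP ux /IH le]; apply: leq_trans (hamming_triangle u x _) _.
by rewrite ux.
Qed.

(** Removing loops leaves a path no longer than the distance, which bounds every path from below.
    The inclusion of vertices lets freeness pass to the shortened path. *)
Lemma shortest_of_walk h (u v : h.-tuple bool) p :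
  path (@hypercube h) u p -> last u p = v -> size p <= hamming u v ->
  exists q, [/\ is_shortest_path (@hypercube h) u v q, size q <= size p & {subset q <= p}].
Proof.
move=> pth lst sz; case: (shortenP pth) lst => q pq uq sub lst.
have le : size q <= size p by apply: uniq_leq_size sub; case/andP: uq.
exists q; split; [|exact: le|by move=> x /sub].
split=> [|r /and3P [pr /eqP lr _]]; first by rewrite /is_upath pq uq lst eqxx.
by apply: leq_trans (leq_trans le sz) _; rewrite -lr hamming_path.
Qed.

Lemma walk_tflips h ds (u : h.-tuple bool) : {in ds, forall i, i < h} ->
  exists p, [/\ path (@hypercube h) u p, last u p = tflips ds u & size p = size ds].
Proof.
elim: ds => [|i ds IH] lds; first by exists [::]; split=> //; apply/val_inj.
have [j jds|p [pp lp sp]] := IH; first by apply: lds; rewrite in_cons jds orbT.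
exists (rcons p (tflips (i :: ds) u)); split; last by rewrite size_rcons sp.
  rewrite rcons_path pp lp (_ : tflips (i :: ds) u = tflips [:: i] (tflips ds u)).
    by apply: hypercube_tflips; apply: lds; rewrite mem_head.
  exact/val_inj.
by rewrite last_rcons.
Qed.

(** The passage from sets of tuples to predicates on plain words; words of length other than [h]
    count as outside. *)
Definition indicator h (M : {set h.-tuple bool}) : pred (seq bool) :=
  fun u => u \in [seq val t | t <- enum M].

Lemma indicatorE h (M : {set h.-tuple bool}) (t : h.-tuple bool) :
  indicator M t = (t \in M).
Proof. by rewrite /indicator (mem_map val_inj) mem_enum. Qed.

Lemma card_cnt h (f : pred (seq bool)) : #|[set t : h.-tuple bool | f t]| = cnt h f.
Proof.
rewrite /cnt /tab count_map -size_filter cardE -(size_map val).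
apply/perm_size/uniq_perm; rewrite ?filter_uniq ?enumc_uniq //.
  by rewrite map_inj_uniq ?enum_uniq //; apply: val_inj.
move=> w; rewrite mem_filter mem_enumc; apply/mapP/andP => [[t + ->]|[fw /eqP sw]].
  by rewrite mem_enum inE size_tuple eqxx.
by exists (Tuple (introT eqP sw)); rewrite // mem_enum inE.
Qed.

(** The first vertex after [u] on a free shortest path differs from both ends, as they are at
    distance at least 2, so it lies outside [M]. *)
Lemma dual_mutual_visibility_starred h (M : {set h.-tuple bool}) :
  dual_mutual_visibility_set (@hypercube h) M -> starred h (indicator M).
Proof.
move=> [visM visC] u0 ds su uds lds lt1.
have [u ->] : exists u : h.-tuple bool, u0 = u by exists (Tuple (introT eqP su)).
set v := tflips ds u; rewrite -[flips ds u]/(val v) !indicatorE => e.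
have [p [[/and3P [pth /eqP lst _] short] free]] : visible (@hypercube h) M u v.
  case: (boolP (u \in M)) e => [uM /esym vM|uM /esym/negbT vM]; first exact: visM.
  exact: visC.
have dist : hamming u v = size ds by apply: hamming_tflips.
have szp : size p <= size ds.
  have [q [pq lq sq]] := walk_tflips u lds.
  have [|r [[ur _] ler _]] := shortest_of_walk pq lq; first by rewrite sq dist.
  by rewrite -sq (leq_trans (short r ur)).
case: p pth lst short free szp => [|x p] /=.
  by move=> _ uv; move: lt1; rewrite -dist -uv hamming_self.
move=> /andP [/[dup] ux /hypercubeP [i ih xE] pth] lst _ free szp.
have ids : i \in ds.
  (* Were [i] not in [ds], then [x] and [v] would differ in all of [i :: ds], too far apart for the
     rest of the path. *)
  apply: contraTT (hamming_path pth) => nids; rewrite lst -ltnNge.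
  have vE : v = tflips (i :: ds) x.
    by apply/val_inj; rewrite /= xE /= flips_flip flipK.
  rewrite vE hamming_tflips /= ?nids //; first exact: leqW.
  by move=> j /[!inE] /predU1P [->|/lds].
apply/hasP; exists i => //; rewrite (_ : flip i u = x) ?xE // -xE indicatorE.
have := free x; rewrite in_cons mem_head orbT !inE => /(_ isT).
rewrite negb_and negbK => /orP [] //.
have xv : hamming x v <= size p by rewrite -lst hamming_path.
case/orP => /eqP xe.
  by move: ux; rewrite /hypercube xe hamming_self.
by move: ux; rewrite /hypercube xe dist; case: (size ds) lt1 => [|[]].
Qed.

(** * Greedy geodesics as certificates of visibility *)

Fixpoint vis (k : nat) (f : pred (seq bool)) (u : seq bool) (ds : seq nat) : bool :=
  if k is k'.+1 then
    hasc (fun i => let v := flip i u in if f v then false else vis k' f v (rem i ds)) ds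
  else true.

(** [k] counts interior vertices: each of the first [k] flips must land outside [f], while the last
    one reaches the endpoint, which may lie in [f]. *)
Lemma vis_walk h f k ds (u : h.-tuple bool) : size ds = k.+1 -> uniq ds ->
  {in ds, forall i, i < h} -> vis k f u ds ->
  exists p, [/\ path (@hypercube h) u p, last u p = tflips ds u, size p = size ds &
    {in p, forall w : h.-tuple bool, f w -> w = tflips ds u}].
Proof.
elim: k ds u => [|k IH] ds u szds uds lds /=.
  case: ds szds uds lds => [|i [|]] //= _ _ lds _; exists [:: tflips [:: i] u].
  split=> //=; first by rewrite hypercube_tflips // lds // mem_head.
  by move=> w /[!inE] /eqP.
rewrite hascE => /hasP [i ids]; case: ifP => // nf vis_i.
have [||||p [pp lp sp fp]] := IH (rem i ds) (tflips [:: i] u).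
- by rewrite size_rem // szds.
- exact: rem_uniq.
- by move=> j /mem_rem/lds.
- exact: vis_i.
have e : tflips (rem i ds) (tflips [:: i] u) = tflips ds u.
  by apply/val_inj; rewrite /= flips_rem.
exists (tflips [:: i] u :: p); split=> /=.
- by rewrite hypercube_tflips ?lds.
- by rewrite lp e.
- by rewrite sp size_rem // szds.
- by move=> w /predU1P [->|/fp]; [rewrite /= nf|rewrite e].
Qed.

Lemma vis_dual h f :
  (forall u ds, size u = h -> ds \in sublists (iota 0 h) -> f u = f (flips ds u) ->
     vis (size ds).-1 f u ds) ->
  dual_mutual_visibility_set (@hypercube h) [set t : h.-tuple bool | f t].
Proof.
move=> visf.
have main (u v : h.-tuple bool) : f u = f v ->
    visible (@hypercube h) [set t : h.-tuple bool | f t] u v.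
  move=> e; have vE : v = tflips (diff u v) u.
    by apply/val_inj; rewrite /= flips_diff ?size_tuple.
  have lds : {in diff u v, forall i, i < h} by move=> i /diff_lt; rewrite size_tuple.
  have duv := @hamming_tflips h _ u (uniq_diff u v) lds; rewrite -vE in duv.
  have [p [pp lp sp fp]] : exists p, [/\ path (@hypercube h) u p, last u p = v,
      size p = size (diff u v) & {in p, forall w : h.-tuple bool, f w -> w = v}].
    case E : (size (diff u v)) => [|k].
      exists [::]; split=> //; rewrite vE; move/size0nil: E => ->; exact/val_inj.
    rewrite -E; have := @vis_walk h f k _ u E (uniq_diff u v) lds; rewrite -vE; apply.
    have := visf u (diff u v); rewrite E; apply; first exact: size_tuple.
      by rewrite /diff size_tuple filter_sublists.
    by rewrite flips_diff ?size_tuple.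
  have [|q [sq _ sub]] := shortest_of_walk pp lp; first by rewrite sp duv.
  exists q; split=> // w; rewrite in_cons !inE => /predU1P [->|/sub/fp fw].
    by rewrite eqxx.
  by case: (boolP (f w)) => [/fw ->|]; rewrite ?eqxx ?orbT // andbF.
split=> u v; rewrite !inE => fu fv; apply: main; first by rewrite fu fv.
by rewrite (negbTE fu) (negbTE fv).
Qed.

(** * Upper and lower bounds on [mu_d] *)

Lemma mu_d_le h b :
  (forall f, starred h f -> cnt h f <= b) -> mu_d (@hypercube h) <= b.
Proof.
move=> le_b; apply/bigmax_leqP => M /asboolP /dual_mutual_visibility_starred/le_b.
rewrite -card_cnt; congr (_ <= _); apply: eq_card => t.
by rewrite inE indicatorE.
Qed.

Lemma mu_d_ge h (M : {set h.-tuple bool}) :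
  dual_mutual_visibility_set (@hypercube h) M -> #|M| <= mu_d (@hypercube h).
Proof. by move=> dM; apply: (bigmax_sup M) => //; apply/asboolP. Qed.

Lemma starred_double h b :
  (forall f, starred h f -> cnt h f <= b) -> forall f, starred h.+1 f -> cnt h.+1 f <= 2 * b.
Proof.
move=> le_b f sf; rewrite cntS mul2n -addnn leq_add // le_b //;
  by apply: starred_embedding sf; apply: embedding_cons.
Qed.

(** Vertices are named by their binary value, the first coordinate being the most significant
    bit. *)
Definition witness (h : nat) (ns : seq nat) : pred (seq bool) :=
  let t := trie_of [seq nth [::] (enumc h) n | n <- ns] in fun u => live (walk t u).

Definition vis_all (h : nat) (f : pred (seq bool)) : bool :=
  let dd := sublists (iota 0 h) in
  allc (fun u => let b := f u in
    allc (fun ds => if eqb b (f (flips ds u)) then vis (size ds).-1 f u ds else true) dd)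
    (enumc h).

Lemma vis_all_ge h f : vis_all h f -> cnt h f <= mu_d (@hypercube h).
Proof.
rewrite /vis_all allcE => /allP visf; rewrite -card_cnt; apply/mu_d_ge/vis_dual.
move=> u ds su dsI e; have := visf u; rewrite mem_enumc su eqxx => /(_ isT).
by rewrite allcE => /allP/(_ _ dsI); rewrite e; case: (f _).
Qed.

(* Two neighbours of a vertex are at distance 2, so at most one of the possible
   next steps of a geodesic is blocked. *)
Lemma vis_sparse h f k u ds :
  (forall v i j, size v = h -> i < h -> j < h -> i != j -> ~~ (f (flip i v) && f (flip j v))) ->
  size u = h -> uniq ds -> {in ds, forall i, i < h} -> size ds = k.+1 -> vis k f u ds.
Proof.
move=> sparse; elim: k u ds => //= k IH u ds su uds lds sz; rewrite hascE.
have step i : i \in ds -> ~~ f (flip i u) ->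
    has (fun i => let v := flip i u in if f v then false else vis k f v (rem i ds)) ds.
  move=> ids nf; apply/hasP; exists i => //=; rewrite (negbTE nf); apply: IH.
  - by rewrite size_flip.
  - exact: rem_uniq.
  - by move=> j /mem_rem/lds.
  - by rewrite size_rem // sz.
case: ds sz uds lds step => [|i [|j ds]] //= _ /andP [nij _] lds step.
have mi : i \in [:: i, j & ds] by rewrite mem_head.
have mj : j \in [:: i, j & ds] by rewrite !inE eqxx orbT.
have ij : i != j by apply: contraNneq nij => ->; rewrite mem_head.
have := sparse u i j su (lds i mi) (lds j mj) ij.
by rewrite negb_and => /orP [/(step i mi)|/(step j mj)].
Qed.

(** * The lower bound from codes of minimum distance 4 *)

Lemma code_le_mu_d h (C : {set h.-tuple bool}) : 0 < h -> code_min_dist 4 C ->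
  2 * #|C| <= mu_d (@hypercube h).
Proof.
move=> h0 /forall_inP codeC.
have far (x y : h.-tuple bool) : x \in C -> y \in C -> x != y -> 3 < hamming x y.
  by move=> /codeC/forall_inP cC /cC/implyP.
pose f0 := tflips (h := h) [:: 0].
have f0K : involutive f0 by move=> t; apply/val_inj; exact: flipK.
have h01 x : hamming x (f0 x) = 1 by apply: hamming_tflips => // i /[!inE] /eqP ->.
have cardM : #|C :|: f0 @^-1: C| = 2 * #|C|.
  rewrite cardsU (card_preimset _ (can_inj f0K)).
  rewrite (_ : C :&: _ = set0) ?cards0 ?subn0 ?mul2n ?addnn //.
  (* [C] and its translate are disjoint: a common [x] would put [x] and [f0 x], at distance 1, both
     in [C]. *)
  apply/setP => x; rewrite !inE; apply/negP => /andP [xC fxC].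
  have := far x (f0 x) xC fxC; rewrite h01.
  by case: eqP (h01 x) => [<-|_ _ /(_ isT)]; rewrite ?hamming_self.
pose f u := indicator C u || indicator C (flip 0 u).
have fE (t : h.-tuple bool) : f t = (t \in C :|: f0 @^-1: C).
  by rewrite !inE /f indicatorE -[flip 0 t]/(val (f0 t)) indicatorE.
rewrite -cardM (_ : _ :|: _ = [set t : h.-tuple bool | f t]); last first.
  by apply/setP => t; rewrite [RHS]inE fE.
apply/mu_d_ge/vis_dual => u ds su /sublists_subseq sub _.
case sz : (size ds) => [//|k] /=.
apply: (@vis_sparse h) sz => //; last 2 first.
- exact: subseq_uniq sub (iota_uniq _ _).
- by move=> i /(mem_subseq sub); rewrite mem_iota.
move=> v0 i j sv ih jh ij.
have [v ->] : exists v : h.-tuple bool, v0 = v by exists (Tuple (introT eqP sv)).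
pose x := tflips [:: i] v; pose y := tflips [:: j] v.
rewrite -[flip i v]/(val x) -[flip j v]/(val y) !fE !inE.
have ij2 (t : h.-tuple bool) : hamming t (tflips [:: i; j] t) = 2.
  rewrite hamming_tflips /= ?inE ?ij // => l /[!inE] /orP [] /eqP -> //.
have xyE : y = tflips [:: i; j] x by apply/val_inj; rewrite /= [flip j (flip i _)]flipC flipK.
have dxy : hamming x y = 2 by rewrite xyE.
have dfxy : hamming (f0 x) (f0 y) = 2.
  by rewrite xyE -(ij2 (f0 x)); congr hamming; apply/val_inj; exact/esym/(flips_flip [:: i; j]).
(* The codewords [a] and [f0 b] are at distance at most 2 + 1 < 4, hence equal; but then [a] and [b]
   are at distance 1, not 2. *)
have mixed (a b : h.-tuple bool) : hamming a b = 2 -> a \in C -> f0 b \in C -> False.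
  move=> ab aC bC; have [e|/(far _ _ aC bC)] := eqVneq a (f0 b).
    by move: ab; rewrite e hammingC h01.
  by rewrite ltnNge (leq_trans (hamming_triangle a b _)) // ab h01.
have close (a b : h.-tuple bool) : hamming a b = 2 -> a \in C -> b \in C -> False.
  move=> ab aC bC; have [e|/(far _ _ aC bC)] := eqVneq a b; last by rewrite ab.
  by move: ab; rewrite e hamming_self.
apply/negP => /andP [] /orP [] xC /orP [] yC.
- exact: close dxy xC yC.
- exact: mixed dxy xC yC.
- by apply: mixed yC xC; rewrite hammingC.
- exact: close dfxy xC yC.
Qed.

Lemma A_le_mu_d h : 0 < h -> 2 * A h 4 <= mu_d (@hypercube h).
Proof.
move=> h0; have code0 : code_min_dist 4 (set0 : {set h.-tuple bool}).
  by apply/forall_inP => x; rewrite inE.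
rewrite /A; have [|C /= codeC ->] :=
  @eq_bigmax_cond _ [pred C : {set h.-tuple bool} | code_min_dist 4 C] (fun C => #|C|).
  (* The empty code makes the family nonempty, so the maximum is attained. *)
  by apply/card_gt0P; exists set0.
exact: code_le_mu_d.
Qed.

(** * Small cubes and the final assembly *)

Lemma cnt_le_words n l b : (forall f, starred n f -> tab n f \in l) ->
  all (fun w => count id w <= b) l -> forall f, starred n f -> cnt n f <= b.
Proof. by move=> lP /allP le_b f /lP/le_b. Qed.

Lemma cnt1_le2 f : starred 1 f -> cnt 1 f <= 2.
Proof. by move=> _; rewrite -[2](size_tab 1 f) count_size. Qed.

Lemma cnt2_le3 f : starred 2 f -> cnt 2 f <= 3.
Proof. by apply: (cnt_le_words mem_w2); vm_compute. Qed.

Lemma cnt3_le4 f : starred 3 f -> cnt 3 f <= 4.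
Proof. by apply: (cnt_le_words mem_w3); vm_compute. Qed.

Lemma cnt_ge7 k f : starred (k + 7) f -> cnt (k + 7) f <= 29 * 2 ^ k.
Proof.
elim: k f => [|k IH] f; first by rewrite muln1; apply: cnt7_le29.
by move=> sf; rewrite expnS mulnCA; apply: (starred_double IH sf).
Qed.

Lemma mu_d_eq h b ns : (forall f, starred h f -> cnt h f <= b) ->
  (if vis_all h (witness h ns) then cnt h (witness h ns) == b else false) ->
  mu_d (@hypercube h) = b.
Proof.
move=> /mu_d_le le_b; case: ifP => // /vis_all_ge ge_b /eqP e.
by apply/anti_leq; rewrite le_b -[X in X <= _]e ge_b.
Qed.

Theorem theorem3p14 :
  [/\ mu_d (@hypercube 1) = 2,
      mu_d (@hypercube 2) = 3,
      mu_d (@hypercube 3) = 4 &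
      mu_d (@hypercube 4) = 8] /\
  [/\ mu_d (@hypercube 5) = 10,
      mu_d (@hypercube 6) = 20 &
      mu_d (@hypercube 7) = 29] /\
  (forall h : nat, 8 <= h ->
     2 * A h 4 <= mu_d (@hypercube h) <= 29 * 2 ^ (h - 7)).
Proof.
split; first split.
- by apply: (mu_d_eq (ns := [:: 0; 1]) cnt1_le2); vm_compute.
- by apply: (mu_d_eq (ns := [:: 0; 1; 2]) cnt2_le3); vm_compute.
- by apply: (mu_d_eq (ns := [:: 0; 1; 2; 4]) cnt3_le4); vm_compute.
(* The upper bound 8 is twice the bound for Q_3, as 20 for Q_6 is twice the bound for Q_5. *)
- apply: (mu_d_eq (ns := [:: 3; 4; 6; 7; 8; 9; 11; 12])).
    exact: starred_double cnt3_le4.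
  by vm_compute.
split; first split.
- apply: (mu_d_eq (ns := [:: 8; 15; 16; 20; 21; 23; 24; 26; 27; 31]) cnt5_le10).
  by vm_compute.
- apply: (mu_d_eq (ns := [:: 0; 4; 6; 7; 8; 9; 11; 15; 23; 24; 36; 43; 51; 52; 53;
      55; 56; 58; 59; 60])).
    exact: starred_double cnt5_le10.
  by vm_compute.
- apply: (mu_d_eq (ns := [:: 1; 2; 3; 6; 9; 22; 25; 30; 35; 44; 53; 57; 60; 61; 62;
      67; 76; 83; 86; 87; 89; 91; 100; 101; 104; 106; 108; 117; 119]) cnt7_le29).
  by vm_compute.
move=> h h8; rewrite A_le_mu_d ?(leq_trans _ h8) //=.
(* Only the two occurrences of [h] as a dimension become [h - 7 + 7]; the exponent is left alone. *)
apply: mu_d_le => f; rewrite -{1 2}(subnK (leq_trans (isT : 7 <= 8) h8)).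
exact: cnt_ge7.
Qed.
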